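(* Let $k\geq 2$ be an integer. For $n\geq 1$ let $\mathcal{B}_n(1^k)$ be the set of binary words of length $n$ containing no $k$ consecutive 1s, let $v_{n,k}$ be the total number of 1s over all words of $\mathcal{B}_n(1^k)$, and let $\alpha_{n,k}=\frac{v_{n,k}}{n\cdot|\mathcal{B}_n(1^k)|}$ (the expected value of a random bit in a uniformly random word of $\mathcal{B}_n(1^k)$). Then $$\lim_{n\to\infty}\alpha_{n,k}=\frac{kx^k-kx^{k-1}-x^k+1}{kx^k-kx^{k-1}+x^{2k}-3x^k+2}\bigg|_{x=1/\varphi_k},$$ where $\varphi_k$ is the generalized golden ratio.
   Context: The $k$-step Fibonacci numbers are $f_{n,k}=0$ for $0\le n\le k-2$, $f_{k-1,k}=1$, and $f_{n,k}=\sum_{i=1}^k f_{n-i,k}$ for $n\geq k$. The generalized golden ratio is $\varphi_k=\lim_{n\to\infty}f_{n+1,k}/f_{n,k}$ (so $\varphi_2$ is the golden ratio). *)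

(* Defs.v *)
From HB Require Import structures.
From mathcomp Require Import all_boot all_order all_algebra.
From mathcomp Require Import all_classical all_reals all_analysis.

Set Implicit Arguments.
Unset Strict Implicit.
Unset Printing Implicit Defensive.

Import Order.TTheory GRing.Theory Num.Theory.
Import numFieldNormedType.Exports.

(* [kfib_window k n] is the sequence [:: f_n; ...; f_(n + k - 1)] of k
   consecutive k-step Fibonacci numbers; [kfib0], [kfib1] and [kfibE] below
   are the defining equations of f. *)
Definition kfib_window (k n : nat) : seq nat :=
  iter n (fun s => rcons (behead s) (sumn s)) (rcons (nseq k.-1 0) 1).

Definition kfib (k n : nat) : nat := head 0 (kfib_window k n).

Lemma size_kfib_window k n : 0 < k -> size (kfib_window k n) = k.
Proof.
move=> k0; elim: n => [|n IH].
  by rewrite /kfib_window /= size_rcons size_nseq prednK.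
by rewrite /kfib_window iterS size_rcons size_behead IH prednK.
Qed.

Lemma nth_kfib_window k n i : 0 < k -> i < k ->
  nth 0 (kfib_window k n) i = kfib k (n + i).
Proof.
move=> k0; elim: i n => [|i IH] n ik; first by rewrite addn0 nth0.
rewrite -addSnnS -IH ?(ltnW ik) // /kfib_window iterS -/(kfib_window k n).
by rewrite nth_rcons nth_behead size_behead size_kfib_window // ltn_predRL ik.
Qed.

Lemma kfib0 k n : 2 <= k -> n <= k - 2 -> kfib k n = 0.
Proof.
move=> k2 nk; have k0 : 0 < k by exact: ltnW.
have nk' : n < k.-1 by case: k k2 nk {k0} => [|[|k]] //= _; rewrite subSS subSS subn0.
have nk2 : n < k by exact: leq_trans nk' (leq_pred _).
rewrite -[n]add0n -nth_kfib_window //= nth_rcons size_nseq nk'.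
by rewrite nth_nseq nk'.
Qed.

Lemma kfib1 k : 2 <= k -> kfib k (k - 1) = 1.
Proof.
move=> k2; have k0 : 0 < k by exact: ltnW.
rewrite subn1 -[k.-1]add0n -nth_kfib_window ?prednK //=.
by rewrite nth_rcons size_nseq ltnn eqxx.
Qed.

Lemma kfibE k n : 2 <= k -> k <= n ->
  kfib k n = \sum_(1 <= i < k.+1) kfib k (n - i).
Proof.
move=> k2 kn; have k0 : 0 < k by exact: ltnW.
rewrite -{1}(subnK kn); set m := n - k.
have -> : m + k = m.+1 + k.-1 by rewrite addSnnS prednK.
rewrite -nth_kfib_window ?prednK // /kfib_window iterS -/(kfib_window k m).
rewrite nth_rcons size_behead size_kfib_window // ltnn eqxx.
rewrite sumnE (big_nth 0) size_kfib_window // big_nat_rev /=.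
rewrite big_add1 /=; apply: eq_big_nat => i /andP[_ ik].
rewrite add0n nth_kfib_window //; last by rewrite ltn_subrL k0.
by rewrite /m addnBA // subnK.
Qed.

Definition avoiding (k n : nat) : {set n.-tuple bool} :=
  [set w : n.-tuple bool | ~~ infix (nseq k true) w].

Definition total_ones (k n : nat) : nat :=
  \sum_(w in avoiding k n) count_mem true w.

Local Open Scope classical_set_scope.
Local Open Scope ring_scope.

Definition golden_ratio (R : realType) (k : nat) : R :=
  lim ((kfib k n.+1)%:R / (kfib k n)%:R @[n --> \oo] : set_system R).

Definition bit_mean (R : realType) (k n : nat) : R :=
  (total_ones k n)%:R / (n%:R * #|avoiding k n|%:R).

(* Main.v *)
Require Import Defs.
From HB Require Import structures.
From mathcomp Require Import all_boot all_order all_algebra.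
From mathcomp Require Import all_classical all_reals all_analysis.
From mathcomp Require Import ring lra zify.

Import Order.TTheory GRing.Theory Num.Theory.
Import numFieldNormedType.Exports.

Local Open Scope classical_set_scope.
Local Open Scope ring_scope.

(** Let [x] be the root of [x + ... + x^k = 1] in (0, 1). Cutting a word after its
    first zero shows that [b_n := |B_n(1^k)|] satisfies the k-step Fibonacci
    recurrence, so that [b_n x^n] is a weighted average of its [k] predecessors with
    weights [x, ..., x^k]; the oscillation of such a sequence over a window
    contracts, so it converges to a positive limit. The same argument for the
    Fibonacci numbers gives [phi_k = 1 / x]. The total number of zeros [z_n] satisfies
    the same recurrence with the extra source term [b_n]. With [mu := \sum_i i x^i],
    the sequence [z_n x^n - n b_n x^n / mu] is therefore averaging up to an error
    tending to 0, hence is o(n) by Cesaro's lemma. So the density of zeros tends to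
    [1 / mu], and [1 - 1 / mu] is the announced rational function of [x]. *)

(** * Recurrences for words avoiding [1^k] and for Fibonacci numbers *)

Section Counting.
Local Open Scope nat_scope.
Variable k : nat.

(** An occurrence of [1^k] cannot contain the zero, and the [j] ones before it are too few to hold
    one. *)
Lemma infix_run_false (j : nat) (w : seq bool) : j < k ->
  infix (nseq k true) (nseq j true ++ false :: w) = infix (nseq k true) w.
Proof.
have pre i : i < k -> prefix (nseq k true) (nseq i true ++ false :: w) = false.
  elim: i (k) => [|i IH] [|k'] //= ik.
  exact: IH.
elim: j => [|j IH] jk.
  by rewrite cat0s infix_consl (pre 0).
rewrite (_ : nseq j.+1 true ++ _ = true :: nseq j true ++ false :: w) //.
by rewrite infix_consl (pre j.+1 jk) IH // ltnW.
Qed.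

(** The prefix of [j] ones remembers the run just read, so words can be scanned letter by letter:
    [j = 0] ranges over [avoiding k n], and [j = k] over no word. *)
Definition run_sum (j n : nat) (F : seq bool -> nat) : nat :=
  \sum_(w : n.-tuple bool | ~~ infix (nseq k true) (nseq j true ++ w)) F w.

Lemma big_tuple_cons (n : nat) (P : pred (seq bool)) (F : seq bool -> nat) :
  \sum_(w : n.+1.-tuple bool | P w) F w =
  \sum_(w : n.-tuple bool | P (false :: w)) F (false :: w) +
  \sum_(w : n.-tuple bool | P (true :: w)) F (true :: w).
Proof.
rewrite (reindex (fun p : bool * n.-tuple bool => cons_tuple p.1 p.2)) /=; last first.
  exists (fun w => (thead w, [tuple of behead w])) => [[b w] _|w _] /=.
    by rewrite theadE; congr pair; apply/val_inj.
  by rewrite [RHS]tuple_eta; apply/val_inj.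
rewrite big_mkcond /= -(pair_big xpredT xpredT (fun b (w : n.-tuple bool) =>
  if P (b :: w) then F (b :: w) else 0)) /= big_bool addnC.
by rewrite -!big_mkcond.
Qed.

Lemma run_sumS (j n : nat) (F : seq bool -> nat) : j < k ->
  run_sum j n.+1 F =
  run_sum 0 n (fun w => F (false :: w)) + run_sum j.+1 n (fun w => F (true :: w)).
Proof.
move=> jk; rewrite /run_sum
  (big_tuple_cons n (fun w => ~~ infix (nseq k true) (nseq j true ++ w)) F).
congr (_ + _); apply: eq_bigl => w; first by rewrite infix_run_false.
by rewrite -cat_rcons -[in RHS]addn1 nseqD cats1.
Qed.

Lemma run_sum_full (n : nat) (F : seq bool -> nat) : run_sum k n F = 0.
Proof. by apply: big_pred0 => w; rewrite prefix_infix // prefix_prefix. Qed.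

Lemma run_sum_unfold (F : seq bool -> nat) (m j n : nat) :
  (forall w, F (true :: w) = F w) -> j + m <= k ->
  run_sum j (n + m) F =
  \sum_(i < m) run_sum 0 (n + m - i.+1) (fun w => F (false :: w)) +
  run_sum (j + m) n F.
Proof.
move=> Ft; elim: m j n => [|m IH] j n jm; first by rewrite big_ord0 !addn0.
rewrite addnS run_sumS; last lia.
rewrite big_ord_recl subSS subn0 -addnA; congr (_ + _).
rewrite (_ : run_sum _ _ _ = run_sum j.+1 (n + m) F); last exact: eq_bigr.
by rewrite IH ?addSnnS.
Qed.

(* Words are split at their first zero, which is preceded by fewer than [k] ones. *)
Lemma run_sum_rec (F : seq bool -> nat) (n : nat) :
  (forall w, F (true :: w) = F w) ->
  run_sum 0 (n + k) F =
  \sum_(i < k) run_sum 0 (n + k - i.+1) (fun w => F (false :: w)).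
Proof. by move=> Ft; rewrite run_sum_unfold // run_sum_full addn0. Qed.

Definition total_zeros (n : nat) : nat :=
  \sum_(w in avoiding k n) count_mem false w.

Lemma run_sum0E (n : nat) (F : seq bool -> nat) :
  run_sum 0 n F = \sum_(w in avoiding k n) F w.
Proof. by apply: eq_bigl => w; rewrite inE. Qed.

Lemma card_avoiding_rec (n : nat) :
  #|avoiding k (n + k)| = \sum_(i < k) #|avoiding k (n + k - i.+1)|.
Proof.
rewrite -sum1_card -(run_sum0E _ (fun=> 1)) run_sum_rec //.
by apply: eq_bigr => i _; rewrite run_sum0E sum1_card.
Qed.

(** The zero closing the initial run adds one per word, whence the cardinals. *)
Lemma total_zeros_rec (n : nat) :
  total_zeros (n + k) = \sum_(i < k)
    (total_zeros (n + k - i.+1) + #|avoiding k (n + k - i.+1)|).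
Proof.
rewrite /total_zeros -run_sum0E run_sum_rec //.
apply: eq_bigr => i _; rewrite run_sum0E /= big_split /= addnC.
by rewrite sum1_card.
Qed.

Lemma total_onesD_zeros (n : nat) :
  total_ones k n + total_zeros n = n * #|avoiding k n|.
Proof.
rewrite /total_ones /total_zeros -big_split /= -sum1_card big_distrr /=.
apply: eq_bigr => w _; rewrite muln1 -[RHS](size_tuple w) -(count_predC (pred1 true)).
by congr (_ + _); apply: eq_count => -[].
Qed.

Lemma card_avoiding_gt0 (n : nat) : 0 < k -> 0 < #|avoiding k n|.
Proof.
move=> k0; apply/card_gt0P; exists [tuple of nseq n false]; rewrite inE.
apply/infixP => -[p [s /(congr1 (fun w => true \in w))]].
by rewrite !mem_cat !mem_nseq /= k0 andbF orbT.
Qed.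

(** The shift by [k.-1] skips the initial zeros, as [scaled_cvg] needs positivity from index 0
    on. *)
Lemma kfib_gt0 (n : nat) : 2 <= k -> 0 < kfib k (n + k.-1).
Proof.
move=> k2; elim: n => [|n IH]; first by rewrite add0n -subn1 kfib1.
rewrite kfibE //; last lia.
rewrite big_ltn; last lia.
by rewrite addn_gt0 (_ : n.+1 + k.-1 - 1 = n + k.-1) ?IH //; lia.
Qed.

Lemma kfib_rec (n : nat) : 2 <= k ->
  kfib k (n + k + k.-1) = \sum_(i < k) kfib k (n + k - i.+1 + k.-1).
Proof.
move=> k2; rewrite kfibE //; last lia.
rewrite big_add1 /= big_mkord; apply: eq_bigr => i _; congr kfib.
have := ltn_ord i; lia.
Qed.

End Counting.

(** * Sequences that are weighted averages of their [k] predecessors *)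

Section Averaging.
Variables (R : realType) (k : nat) (p : nat -> R) (d : R).
Hypotheses (d_gt0 : 0 < d) (d_le : forall i, (i < k)%N -> d <= p i).
Hypothesis sum_p : \sum_(i < k) p i = 1.

Definition averaging (u : nat -> R) : Prop :=
  forall n, u (n + k)%N = \sum_(i < k) p i * u (n + k - i.+1)%N.

Let p_ge0 (i : 'I_k) : 0 <= p i.
Proof. exact: le_trans (ltW d_gt0) (d_le _ (ltn_ord i)). Qed.

Let k_gt0 : (0 < k)%N.
Proof.
case: (posnP k) => // k0; have := sum_p; rewrite k0 big_ord0 => /eqP.
by rewrite eq_sym oner_eq0.
Qed.

Lemma averagingN (u : nat -> R) : averaging u -> averaging (fun n => - u n).
Proof. by move=> hu n; rewrite hu -sumrN; apply: eq_bigr => i _; rewrite mulrN. Qed.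

Lemma averaging_ge (u : nat -> R) (l : R) (N : nat) : averaging u ->
  (forall n, (N <= n < N + k)%N -> l <= u n) ->
  forall n, (N <= n)%N -> l <= u n.
Proof.
move=> hu hl; elim/ltn_ind => n IH Nn.
have [nk|kn] := ltnP n (N + k); first by apply: hl; rewrite Nn.
have kn' : (k <= n)%N by lia.
rewrite -(subnK kn') hu -[l]mul1r -sum_p mulr_suml.
apply: ler_sum => i _; apply: ler_wpM2l => //.
by have ik := ltn_ord i; apply: IH; lia.
Qed.

(* The next [k] values all give weight at least [d] to the common value [u (N + k - 1)]. *)
Lemma averaging_ge_improve (u : nat -> R) (l : R) (N : nat) : averaging u ->
  (forall n, (N <= n)%N -> l <= u n) ->
  forall n, (N + k <= n)%N -> (1 - d) * l + d * u (N + k - 1)%N <= u n.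
Proof.
move=> hu hl; apply: averaging_ge => // n /andP[Nn nN].
have jk : (n - (N + k) < k)%N by lia.
pose j := Ordinal jk.
have kn : (k <= n)%N by lia.
have ul : l <= u (N + k - 1)%N by apply: hl; lia.
have sum_pj : \sum_(i < k | i != j) p i = 1 - p j.
  by rewrite -sum_p [X in _ = X - _](bigD1 j) //= addrC addrK.
rewrite -(subnK kn) hu (bigD1 j) //= subnK //.
rewrite (_ : n - (n - (N + k)).+1 = N + k - 1)%N; last lia.
apply: (@le_trans _ _ (p j * u (N + k - 1)%N + (1 - p j) * l)).
  have := d_le j jk; nra.
rewrite lerD2l -sum_pj mulr_suml; apply: ler_sum => i _.
apply: ler_wpM2l => //; apply: hl; have := ltn_ord i; lia.
Qed.

Let d_le1 : d <= 1.
Proof.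
apply: le_trans (d_le 0 k_gt0) _; rewrite -sum_p (bigD1 (Ordinal k_gt0)) //=.
by rewrite lerDl sumr_ge0.
Qed.

(** Applying [averaging_ge_improve] to [u] and to [- u] moves the lower and upper bounds towards the
    same value of [u], so their gap shrinks by the factor [1 - d] every [k] steps. The lower bounds
    increase from [l0 > 0], so the limit is positive. *)
Lemma averaging_cvg (u : nat -> R) : averaging u -> (forall n, 0 < u n) ->
  exists2 c : R, 0 < c & u n @[n --> \oo] --> c.
Proof.
move=> hu u_gt0.
have [l0 l0_gt0 l0_le] : exists2 l : R, 0 < l & forall n, (n < k)%N -> l <= u n.
  elim: k => [|m [l l_gt0 hl]]; first by exists 1.
  exists (Num.min l (u m)) => [|n]; first by rewrite lt_min l_gt0 u_gt0.
  rewrite ltnS leq_eqVlt ge_min => /orP[/eqP->|nm]; first by rewrite lexx orbT.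
  by rewrite hl.
have [h0 h0_ge] : exists h, forall n, (n < k)%N -> u n <= h.
  exists (\sum_(i < k) u i) => n nk.
  by rewrite (bigD1 (Ordinal nk)) //= lerDl sumr_ge0 // => i _; apply: ltW.
pose fix l (m : nat) : R := if m is m'.+1 then (1 - d) * l m' + d * u (m' * k + k - 1)%N
  else l0.
pose D := h0 - l0.
have lu m n : (m * k <= n)%N -> l m <= u n.
  elim: m n => [|m IH] n /=.
    by apply: averaging_ge => // i; rewrite add0n => /andP[_]; apply: l0_le.
  rewrite mulSn addnC; exact: averaging_ge_improve.
have uh m n : (m * k <= n)%N -> u n <= l m + D * (1 - d) ^+ m.
  rewrite -lerN2; elim: m n => [|m IH] n /=.
    rewrite expr0 mulr1 /D addrC subrK.
    apply: (averaging_ge _ _ _ (averagingN _ hu)) => i; rewrite add0n => /andP[_] ik.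
    by rewrite lerN2 h0_ge.
  rewrite mulSn addnC => mn.
  apply: le_trans (averaging_ge_improve _ _ _ (averagingN _ hu) IH _ mn).
  rewrite exprS; lra.
have l_nd : {homo l : n m / (n <= m)%N >-> n <= m}.
  apply/nondecreasing_seqP => m /=.
  have : l m <= u (m * k + k - 1)%N by apply: lu; lia.
  by rewrite -(ler_pM2l d_gt0); lra.
have l_cvg : cvgn l.
  apply: nondecreasing_is_cvgn => //; exists h0 => _ [m _ <-].
  apply: le_trans (lu m (m * k)%N (leqnn _)) _.
  by apply: le_trans (uh 0 _ _) _ => //; rewrite /= expr0 mulr1 /D addrC subrK.
exists (limn l).
  apply: lt_le_trans l0_gt0 _; apply: limr_ge => //.
  by near=> m; apply: (l_nd 0).
(* The bounds of rank [m] hold from index [m * k] on, so [u n] is squeezed by those of rank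
   [n %/ k]. *)
have divk := cvg_divnr _ k_gt0.
apply: (@squeeze_cvgr _ _ _ _ (fun n => l (n %/ k)%N)
  (fun n => l (n %/ k)%N + D * (1 - d) ^+ (n %/ k))).
- near=> n; have nk : (n %/ k * k <= n)%N by exact: leq_divM.
  by rewrite lu // uh.
- exact: (cvg_comp _ _ divk l_cvg).
rewrite -[X in _ --> X]addr0; apply: cvgD; first exact: (cvg_comp _ _ divk l_cvg).
apply: (cvg_comp _ _ divk (cvg_geometric D _)).
by rewrite ger0_norm; have := d_gt0; have := d_le1; lra.
Unshelve. all: by end_near. Qed.

(** Averaging never increases the maximum of [|w|], so [|w n|] is at most a constant plus a partial
    sum of [|e|]; divided by [n], this is a vanishing term plus a Cesaro mean. *)
Lemma averaging_perturbed (w e : nat -> R) :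
  (forall n, w (n + k)%N = \sum_(i < k) p i * w (n + k - i.+1)%N + e n) ->
  e n @[n --> \oo] --> 0 -> w n / n%:R @[n --> \oo] --> 0.
Proof.
move=> hw e0.
have [C hC] : exists C, forall n, (n < k)%N -> `|w n| <= C.
  exists (\sum_(i < k) `|w i|) => n nk.
  by rewrite (bigD1 (Ordinal nk)) //= lerDl sumr_ge0.
pose S n := \sum_(0 <= j < n) `|e j|.
have bound n m : (m < n + k)%N -> `|w m| <= C + S n.
  elim: n m => [|n IH] m.
    by rewrite add0n /S big_geq // addr0; apply: hC.
  have Sn : S n.+1 = S n + `|e n| by rewrite /S big_nat_recr.
  rewrite addSn ltnS leq_eqVlt => /orP[/eqP->|mn]; last first.
    by apply: le_trans (IH _ mn) _; rewrite Sn addrA lerDl.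
  rewrite hw Sn addrA; apply: le_trans (ler_normD _ _) _; rewrite lerD2r.
  apply: le_trans (ler_norm_sum _ _ _) _.
  rewrite -[X in _ <= X]mul1r -sum_p mulr_suml; apply: ler_sum => i _.
  rewrite normrM ger0_norm //; apply: ler_wpM2l => //; apply: IH.
  lia.
(* The shift matches [harmonic] and [arithmetic_mean], which divide by [n.+1]. *)
apply: norm_cvg0; rewrite -cvg_shiftS /=.
apply: (@squeeze_cvgr _ _ _ _ (fun=> 0) (fun n => C * harmonic n +
   arithmetic_mean (fun j => `|e j|) n)).
- near=> n; rewrite normr_ge0 normrM normfV (ger0_norm (ler0n _ _)) /=.
  rewrite /arithmetic_mean /series /= [n.+1%:R^-1 * _]mulrC -mulrDl.
  by apply: ler_wpM2r => //; apply: bound; lia.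
- exact: cvg_cst.
rewrite -[X in _ --> X]addr0; apply: cvgD.
  by rewrite -[X in _ --> X](mulr0 C); apply: cvgMr; exact: cvg_harmonic.
by apply: cesaro; rewrite -(normr0 R); apply: cvg_norm.
Unshelve. all: by end_near. Qed.

End Averaging.

(** * The root [x], the golden ratio and the density of zeros *)

Section Growth.
Variables (R : realType) (k : nat).
Hypothesis k_ge2 : (2 <= k)%N.

(** Intermediate values: the polynomial [q] is [-1] at 0 and [k - 1 > 0] at 1. *)
Lemma inv_golden_root_exists :
  exists2 x : R, 0 < x < 1 & \sum_(i < k) x ^+ i.+1 = 1.
Proof.
pose q : {poly R} := \sum_(i < k) 'X ^+ i.+1 - 1.
have qE y : q.[y] = \sum_(i < k) y ^+ i.+1 - 1.
  rewrite /q hornerD hornerN hornerC horner_sum; congr (_ - _).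
  by apply: eq_bigr => i _; rewrite hornerXn.
have q0 : q.[0] = -1.
  by rewrite qE big1 ?sub0r // => i _; rewrite expr0n.
have q1 : q.[1] = k%:R - 1.
  rewrite qE; congr (_ - _); under eq_bigr do rewrite expr1n.
  by rewrite sumr_const card_ord.
have k2R : 2 <= k%:R :> R by rewrite ler_nat.
have [||x /andP[x_ge0 x_le1] /rootP qx] := @poly_ivt R q 0 1.
- exact: ler01.
- by rewrite q0 q1; apply/andP; split; lra.
exists x; last by move: qx; rewrite qE => /eqP; rewrite subr_eq0 => /eqP.
rewrite !lt_neqAle x_ge0 x_le1 !andbT; apply/andP; split; apply/eqP => xE.
  by move: qx; rewrite -xE q0; lra.
by move: qx; rewrite xE q1; lra.
Qed.

Variable x : R.
Hypotheses (x01 : 0 < x < 1) (x_root : \sum_(i < k) x ^+ i.+1 = 1).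

Let x_gt0 : 0 < x. Proof. by case/andP: x01. Qed.
Let xX_gt0 n : 0 < x ^+ n. Proof. exact: exprn_gt0. Qed.
(** The smallest weight [x ^+ k] serves as the [d] of the averaging lemmas. *)
Let xX_le i : (i < k)%N -> x ^+ k <= x ^+ i.+1.
Proof.
by move=> ik; apply: ler_wiXn2l => //; [exact: ltW | case/andP: x01 => _ /ltW].
Qed.

Lemma exprB_ord (n : nat) (i : 'I_k) :
  x ^+ (n + k) = x ^+ i.+1 * x ^+ (n + k - i.+1).
Proof. by rewrite -exprD subnKC //; have := ltn_ord i; lia. Qed.

Lemma averaging_scaled (u : nat -> nat) :
  (forall n, u (n + k) = \sum_(i < k) u (n + k - i.+1))%N ->
  averaging R k (fun i => x ^+ i.+1) (fun n => (u n)%:R * x ^+ n).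
Proof.
move=> hu n; rewrite hu natr_sum mulr_suml; apply: eq_bigr => i _.
by rewrite (exprB_ord n i) mulrCA.
Qed.

Lemma scaled_cvg (u : nat -> nat) :
  (forall n, u (n + k) = \sum_(i < k) u (n + k - i.+1))%N ->
  (forall n, 0 < u n)%N ->
  exists2 c : R, 0 < c & (u n)%:R * x ^+ n @[n --> \oo] --> c.
Proof.
move=> hu u_gt0.
apply: (averaging_cvg R k (fun i => x ^+ i.+1) (x ^+ k)) => //.
  exact: averaging_scaled.
by move=> n; rewrite mulr_gt0 // ltr0n.
Qed.

(** The scaled Fibonacci numbers tend to some [c > 0], so the ratio of consecutive ones tends to 1;
    unscaling it leaves [x^-1]. *)
Lemma golden_ratioE : golden_ratio R k = x^-1.
Proof.
have hu n : kfib k (n + k + k.-1) = (\sum_(i < k) kfib k (n + k - i.+1 + k.-1))%N.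
  exact: kfib_rec.
have [c c_gt0 cvg_c] :=
  scaled_cvg (fun n => kfib k (n + k.-1)) hu (fun n => kfib_gt0 k n k_ge2).
apply: cvg_lim => //; rewrite -(cvg_shiftn k.-1) /=.
have -> : x^-1 = c * c^-1 * x^-1 by rewrite divff ?mul1r // gt_eqF.
have cvg_cS := cvg_c; rewrite -cvg_shiftS /= in cvg_cS.
apply: cvg_trans (cvgM (cvgM cvg_cS (cvgV (lt0r_neq0 c_gt0) cvg_c)) (cvg_cst x^-1)).
apply: near_eq_cvg; near=> n => /=.
rewrite addSn exprS; have f_gt0 := kfib_gt0 k n k_ge2.
by field; rewrite !gt_eqF ?ltr0n.
Unshelve. all: by end_near. Qed.

(* The mean length of the blocks [1^i 0] into which a word decomposes. *)
Definition mean_block : R := \sum_(i < k) i.+1%:R * x ^+ i.+1.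

Lemma mean_block_gt0 : 0 < mean_block.
Proof.
have k0 : (0 < k)%N by exact: ltnW.
rewrite /mean_block (bigD1 (Ordinal k0)) //=.
by rewrite ltr_pwDl ?mulr_gt0 // sumr_ge0 // => i _; rewrite mulr_ge0 // ltW.
Qed.

Lemma zeros_density_cvg :
  (total_zeros k n)%:R / (n%:R * #|avoiding k n|%:R) @[n --> \oo] --> mean_block^-1.
Proof.
have k0 : (0 < k)%N by exact: ltnW.
pose B n : R := #|avoiding k n|%:R * x ^+ n.
pose Z n : R := (total_zeros k n)%:R * x ^+ n.
have [b b_gt0 B_cvg] : exists2 b : R, 0 < b & B n @[n --> \oo] --> b.
  by apply: scaled_cvg => n; [exact: card_avoiding_rec | exact: card_avoiding_gt0].
have BE n : B (n + k)%N = \sum_(i < k) x ^+ i.+1 * B (n + k - i.+1)%N.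
  exact: (averaging_scaled (fun n => #|avoiding k n|) (card_avoiding_rec k) n).
have ZE n : Z (n + k)%N = \sum_(i < k) x ^+ i.+1 * Z (n + k - i.+1)%N + B (n + k)%N.
  rewrite BE -big_split /= /Z total_zeros_rec natr_sum mulr_suml.
  apply: eq_bigr => i _; rewrite natrD (exprB_ord n i) /B; ring.
have mu_gt0 := mean_block_gt0; set mu := mean_block in mu_gt0 *.
(* [W] obeys the same averaging recurrence up to an error tending to [b - b = 0]. *)
pose W n := Z n - mu^-1 * n%:R * B n.
pose e n := B (n + k)%N -
  mu^-1 * \sum_(i < k) i.+1%:R * x ^+ i.+1 * B (n + k - i.+1)%N.
have WE n : W (n + k)%N = \sum_(i < k) x ^+ i.+1 * W (n + k - i.+1)%N + e n.
  (* The factor [n + k - i.+1] in [W] is split: [n + k] rebuilds [B (n + k)] by [BE], and [i.+1]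
     gives the sum in [e]. *)
  have -> : \sum_(i < k) x ^+ i.+1 * W (n + k - i.+1)%N =
      \sum_(i < k) x ^+ i.+1 * Z (n + k - i.+1)%N
      - mu^-1 * (n + k)%:R * B (n + k)%N
      + mu^-1 * \sum_(i < k) i.+1%:R * x ^+ i.+1 * B (n + k - i.+1)%N.
    rewrite BE !mulr_sumr -sumrB -big_split /=; apply: eq_bigr => i _.
    rewrite /W natrB; last by have := ltn_ord i; lia.
    ring.
  rewrite {1}/W ZE /e; ring.
have cvge : e n @[n --> \oo] --> 0.
  have -> : 0 = b - mu^-1 * \sum_(i < k) i.+1%:R * x ^+ i.+1 * b :> R.
    by rewrite -mulr_suml -/mean_block -/mu mulKf ?subrr // gt_eqF.
  apply: cvgB; first by rewrite (cvg_shiftn k).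
  apply: cvgMr; apply: (cvg_big add_continuous) => i _.
  apply: cvgMr; rewrite (_ : (fun n => _) = (fun n => B (n + (k - i.+1))%N)).
    by rewrite (cvg_shiftn (k - i.+1) B).
  by apply/funext => n; rewrite addnBA.
have cvgW : W n / n%:R @[n --> \oo] --> 0.
  exact: (averaging_perturbed R k (fun i => x ^+ i.+1) (x ^+ k) _ _ _ _ e).
(* For [n > 0] the density is [mu^-1 + (W n / n) / B n], the powers of [x] cancelling. *)
have -> : mu^-1 = mu^-1 + 0 * b^-1 by rewrite mul0r addr0.
apply: cvg_trans (cvgD (cvg_cst mu^-1) (cvgM cvgW (cvgV (lt0r_neq0 b_gt0) B_cvg))).
apply: near_eq_cvg; near=> n => /=.
have n_gt0 : (0 < n)%N by near: n; exists 1%N.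
rewrite !fctE /W /Z /B /=; field.
by rewrite !gt_eqF ?ltr0n ?card_avoiding_gt0.
Unshelve. all: by end_near. Qed.

Lemma bit_mean_cvg : bit_mean R k n @[n --> \oo] --> 1 - mean_block^-1.
Proof.
apply: cvg_trans (cvgB (cvg_cst (1 : R)) zeros_density_cvg).
apply: near_eq_cvg; near=> n => /=.
have n_gt0 : (0 < n)%N by near: n; exists 1%N.
have := congr1 (fun m => m%:R : R) (total_onesD_zeros k n).
rewrite natrD natrM => /(canRL (addrK _)) onesE.
rewrite /bit_mean onesE mulrBl divff // mulf_neq0 // gt_eqF ?ltr0n //.
by rewrite card_avoiding_gt0 // ltnW.
Unshelve. all: by end_near. Qed.

(** * Closed form of the limit *)

Lemma root_powE : x * (1 - x ^+ k) = 1 - x.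
Proof.
rewrite -[1 - x ^+ k]opprB subrX1 -opprB mulNr opprK mulrCA -[RHS]mulr1 -x_root.
by congr (_ * _); rewrite mulr_sumr; apply: eq_bigr => i _; rewrite exprS.
Qed.

Lemma mean_blockE : (1 - x) * mean_block = 1 - k%:R * x ^+ k.+1.
Proof.
(* With 1 turned back into the geometric sum, the identity holds for every [k] and induction
   applies. *)
rewrite -[X in _ = X - _]x_root /mean_block; elim: (k) => [|m IH].
  by rewrite !big_ord0 mul0r mulr0 subr0.
rewrite !big_ord_recr /= mulrDr IH [x ^+ m.+2]exprS -(natr1 m); ring.
Qed.

Lemma limit_valueE : 1 - mean_block^-1 =
  (k%:R * x ^+ k - k%:R * x ^+ (k - 1) - x ^+ k + 1) /
  (k%:R * x ^+ k - k%:R * x ^+ (k - 1) + x ^+ (2 * k) - 3 * x ^+ k + 2).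
Proof.
have mu_gt0 := mean_block_gt0; have muE := mean_blockE; have pE := root_powE.
set mu := mean_block in mu_gt0 muE *.
have x1 : 0 < 1 - x by rewrite subr_gt0; case/andP: x01.
have kE : x ^+ k = x * x ^+ (k - 1) by rewrite -exprS subn1 prednK // ltnW.
rewrite mulnC exprM expr2.
rewrite exprS kE in muE; rewrite kE in pE *; set y := x ^+ (k - 1) in muE pE *.
set N := (X in _ = X / _); set D := (X in _ = _ / X).
(* This is [x ^+ k.+1 = 2 * x - 1]. Multiplying [N] and [D] by [x ^+ 2] makes [y] occur only through
   this product, so it can be eliminated. *)
have q : x ^+ 2 * y = 2 * x - 1.
  have -> : x ^+ 2 * y = x - x * (1 - x * y) by ring.
  by rewrite pE; ring.
have {}muE : (1 - x) * mu = 1 - k%:R * (2 * x - 1) by rewrite muE -q; ring.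
have NE : N = (1 - x) ^+ 2 * (mu - 1) / x ^+ 2.
  apply: (canRL (mulfK _)); first by rewrite gt_eqF.
  transitivity (k%:R * (x - 1) * (x ^+ 2 * y) - x * (x ^+ 2 * y) + x ^+ 2).
    rewrite /N; ring.
  transitivity ((1 - x) * ((1 - x) * mu) - (1 - x) ^+ 2); last by ring.
  rewrite q muE; ring.
have DE : D = (1 - x) ^+ 2 * mu / x ^+ 2.
  apply: (canRL (mulfK _)); first by rewrite gt_eqF.
  transitivity (k%:R * (x - 1) * (x ^+ 2 * y) + (x ^+ 2 * y) ^+ 2
                - 3 * x * (x ^+ 2 * y) + 2 * x ^+ 2).
    rewrite /D; ring.
  transitivity ((1 - x) * ((1 - x) * mu)); last by ring.
  rewrite q muE; ring.
by rewrite NE DE; field; rewrite !gt_eqF.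
Qed.

End Growth.

Theorem theorem1 (R : realType) (k : nat) (hk : (2 <= k)%N) :
  let x : R := 1 / golden_ratio R k in
  bit_mean R k n @[n --> \oo] -->
    (k%:R * x ^+ k - k%:R * x ^+ (k - 1) - x ^+ k + 1) /
    (k%:R * x ^+ k - k%:R * x ^+ (k - 1) + x ^+ (2 * k) - 3 * x ^+ k + 2).
Proof.
have [y y01 y_root] := inv_golden_root_exists R k hk.
move=> x; have -> : x = y by rewrite /x (golden_ratioE R k hk y) // div1r invrK.
by rewrite -(limit_valueE R k hk y) //; exact: bit_mean_cvg.
Qed.
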